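(* Let $t\ge 3$ be an integer. Then $$\Lambda(t)=\max\left\{n\in\mathbb{N}:\binom{n}{3}\le t\right\},$$ equivalently, for every $n\in\mathbb N$, $\binom{n}{3}\le t<\binom{n+1}{3}$ implies $\Lambda(t)=n$. Consequently $\Lambda(t)=\Theta(t^{1/3})$.
   Context: For a $3$-element subset $T=\{a,b,c\}$ of a totally ordered set with $a<b<c$ and a $2$-element subset $e$, $[T:e]$ is $1$ if $e=\{a,b\}$ or $\{b,c\}$, $-1$ if $e=\{a,c\}$, $0$ if $e\not\subset T$. For a nonempty finite family $\mathcal T$ of $3$-element subsets of a totally ordered set, the support graph $\Gamma_0(\mathcal T)$ has vertex set $\bigcup_{T\in\mathcal T}T$ and edges the pairs contained in some member of $\mathcal T$; $\delta_{1,\mathcal T}$ is the $\mathcal T\times E(\Gamma_0(\mathcal T))$ matrix with entries $[T:e]$, and $\lambda(\mathcal T)$ is the smallest positive eigenvalue of $\delta_{1,\mathcal T}^T\delta_{1,\mathcal T}$. For positive integers $t$, $\phi(t)=\max_{|\mathcal T|=t}\lambda(\mathcal T)$ (the maximum over all such families with $t$ members, finitely many up to relabeling) and $\Lambda(t)=\max_{1\le s\le t}\phi(s)$. *)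

(* Defs.v *)
From HB Require Import structures.
From mathcomp Require Import all_boot all_order all_algebra.
From mathcomp Require Import finmap.
From mathcomp Require Import all_classical all_reals all_analysis.
From mathcomp Require Import complex.

Set Implicit Arguments.
Unset Strict Implicit.
Unset Printing Implicit Defensive.

Import Order.TTheory GRing.Theory Num.Theory.
Import numFieldNormedType.Exports.

Local Open Scope fset_scope.
Local Open Scope classical_set_scope.
Local Open Scope ring_scope.

Section Extrema.
Context {d : Order.disp_t} {T : porderType d}.
Implicit Types (A : set T) (x : T).

Definition is_maximum A x : Prop := A x /\ ubound A x.
Definition is_minimum A x : Prop := A x /\ lbound A x.

(* [x0] is only returned when [A] has no maximum, resp. no minimum. *)
Definition maximum x0 A : T := xget x0 (is_maximum A).
Definition minimum x0 A : T := xget x0 (is_minimum A).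

End Extrema.

Definition smallest_positive_eigenvalue (R : realType) (n : nat)
    (A : 'M[R]_n) : R :=
  minimum 0 [set x : R | 0 < x /\ eigenvalue A x].

Section TripleFamilies.
Context {d : Order.disp_t} {V : orderType d}.
Implicit Types (T e : {fset V}) (F : {fset {fset V}}).

Definition incidence (R : realType) T e : R :=
  if sort <=%O T is [:: a; b; c] then
    if (e == [fset a; b]) || (e == [fset b; c]) then 1
    else if e == [fset a; c] then -1
    else 0
  else 0.

Definition triple_family F : Prop := forall T, T \in F -> #|` T| = 3.

Definition support_vertices F : {fset V} := fcover F.

Definition support_edges F : {fset {fset V}} :=
  [fset e in fpowerset (support_vertices F)
   | (#|` e| == 2)%N && has (fun T => (e `<=` T)%fset) F].

(* Rows and columns follow the internal enumerations of the finite sets [F]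
   and [support_edges F]; another enumeration conjugates [delta^T *m delta]
   by a permutation matrix, which leaves its eigenvalues unchanged. *)
Definition coboundary1 (R : realType) F
    : 'M[R]_(#|` F|, #|` support_edges F|) :=
  \matrix_(i, j) incidence R (nth fset0 F i) (nth fset0 (support_edges F) j).

Definition lambda (R : realType) F : R :=
  smallest_positive_eigenvalue ((coboundary1 R F)^T *m coboundary1 R F).

End TripleFamilies.

(* The ground ordered set is arbitrary and may vary with the family. *)
Definition lambda_values (R : realType) (t : nat) : set R :=
  [set x | exists (d : Order.disp_t) (V : orderType d) (F : {fset {fset V}}),
     [/\ triple_family F, #|` F| = t & lambda R F = x]].
Arguments lambda_values R t : clear implicits.

Definition phi (R : realType) (t : nat) : R := maximum 0 (lambda_values R t).

Definition Lambda (R : realType) (t : nat) : R :=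
  maximum 0 [set phi R s | s in [set s : nat | (1 <= s <= t)%N]].

(* The remaining lemmas show that every extremum above is attained, so that the
   default values of [maximum] and [minimum] never play a role. *)

Lemma is_maximum_seq (d : Order.disp_t) (T : orderType d) (s : seq T)
    (A : set T) :
  A `<=` [set` s] -> A !=set0 -> exists x, is_maximum A x.
Proof.
elim: s A => [|a s IH] A sub [x Ax]; first by have := sub _ Ax.
pose B := A `\ a.
have [[y By]|B0] := pselect (B !=set0); last first.
  have sA z : A z -> z = a.
    by move=> Az; apply: contrapT => za; apply: B0; exists z.
  by exists a; split; [rewrite -(sA x)|move=> z /sA ->].
have [|m [[Am ma] um]] := IH B _ (ex_intro _ y By).
  by move=> z [Az za]; have := sub _ Az; rewrite /= inE => /orP[/eqP|].
have [Aa|nAa] := pselect (A a); last first.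
  exists m; split=> // z Az; apply: um; split=> // /= za.
  by apply: nAa; rewrite -za.
have [am|/ltW ma'] := leP a m.
  exists m; split=> // z Az; have [->//|/eqP za] := eqVneq z a.
  by apply: um.
exists a; split=> // z Az; have [->//|/eqP za] := eqVneq z a.
exact: le_trans (um _ (conj Az za)) ma'.
Qed.

Lemma is_maximum_finite (d : Order.disp_t) (T : orderType d) (A : set T) :
  finite_set A -> A !=set0 -> exists x, is_maximum A x.
Proof. by move=> /finite_seqP[s ->]; apply: (@is_maximum_seq _ _ s). Qed.

Lemma is_minimum_finite (d : Order.disp_t) (T : orderType d) (A : set T) :
  finite_set A -> A !=set0 -> exists x, is_minimum A x.
Proof. exact: (@is_maximum_finite _ T^d). Qed.

Lemma pos_eigenvalue_gram (R : realType) (m n : nat) (D : 'M[R]_(m, n)) :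
  D != 0 -> exists x : R, 0 < x /\ eigenvalue (D^T *m D) x.
Proof.
move=> D0; set A := D^T *m D.
pose toC := @real_complex R.
pose C := R[i].
have trA : 0 < \tr A.
  rewrite /mxtrace.
  have [/existsP[i /existsP[j Dij]]|/existsPn H] :=
    boolP [exists i, exists j, D i j != 0]; last first.
    case/eqP: D0; apply/matrixP => i j; rewrite mxE; apply/eqP.
    by have /existsPn/(_ j)/negPn := H i.
  have ge0 k l : 0 <= D l k * D l k by rewrite -expr2 sqr_ge0.
  rewrite (bigD1 j) //= ltr_pwDl //; last first.
    by apply: sumr_ge0 => k _; rewrite !mxE; apply: sumr_ge0 => l _; rewrite mxE.
  rewrite !mxE (bigD1 i) //= mxE ltr_pwDl //; last first.
    by apply: sumr_ge0 => l _; rewrite mxE.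
  by rewrite lt_neqAle ge0 eq_sym mulf_eq0 negb_or Dij.
have n0 : (0 < n)%N.
  by case: n D D0 @A trA => // D; rewrite thinmx0 eqxx.
pose AC : 'M[C]_n := map_mx toC A.
have [r Dr] := closed_field_poly_normal (char_poly AC).
have /monicP lc := char_poly_monic AC.
rewrite lc scale1r in Dr.
have [/allP r0|/allPn[z zr z0]] := boolP (all (pred1 0) r).
  have : (char_poly AC)`_n.-1 = 0.
    rewrite Dr (eq_big_seq (fun=> 'X)); last first.
      by move=> z /r0 /= /eqP ->; rewrite subr0.
    rewrite big_const_seq count_predT iter_mulr_1 coefXn.
    have := size_char_poly AC; rewrite Dr size_prod_XsubC => -[->].
    by case: (n) n0 => //= k _; rewrite ltn_eqF.
  rewrite char_poly_trace // => /eqP; rewrite oppr_eq0.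
  rewrite /AC trace_map_mx fmorph_eq0.
  by rewrite gt_eqF.
have : root (char_poly AC) z by rewrite Dr root_prod_XsubC.
rewrite -eigenvalue_root_char => zA; have /eigenvalueP[v vA v0] := zA.
pose DC : 'M[C]_(m, n) := map_mx toC D.
pose vs : 'cV[C]_n := map_mx Num.conj v^T.
have sqv k (w : 'rV[C]_k) : (w *m map_mx Num.conj w^T) 0 0 = \sum_i `|w 0 i| ^+ 2.
  by rewrite mxE; apply: eq_bigr => i _; rewrite !mxE normCK.
have E : (v *m AC *m vs) 0 0 = z * \sum_i `|v 0 i| ^+ 2.
  by rewrite vA -scalemxAl mxE sqv.
have E2 : (v *m AC *m vs) 0 0 = \sum_i `|(v *m DC^T) 0 i| ^+ 2.
  have -> : AC = DC^T *m DC by rewrite /AC map_mxM map_trmx.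
  rewrite -sqv !mulmxA -(mulmxA (v *m DC^T)); congr ((_ *m _) 0 0).
  rewrite trmx_mul trmxK map_mxM; congr (_ *m _).
  apply/matrixP => i j; rewrite !mxE; apply/esym/CrealP.
  by rewrite complex_real.
have sv : 0 < \sum_i `|v 0 i| ^+ 2.
  have [i vi] : exists i, v 0 i != 0 by apply/rV0Pn.
  rewrite (bigD1 i) //= ltr_pwDl ?exprn_gt0 ?normr_gt0 //.
  by apply: sumr_ge0 => k _; rewrite exprn_ge0.
have z_ge0 : 0 <= z.
  rewrite -(pmulr_lge0 _ sv) -E E2.
  by apply: sumr_ge0 => k _; rewrite exprn_ge0.
have zgt0 : 0 < z by rewrite lt_neqAle eq_sym z0.
have ez : z = toC (complex.Re z) by rewrite /toC RRe_real // ger0_real.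
exists (complex.Re z); split; first by move: zgt0; rewrite ez ltcR.
by move: zA; rewrite {1}ez eigenvalue_map.
Qed.

Lemma smallest_positive_eigenvalueP (R : realType) (m n : nat)
    (D : 'M[R]_(m, n)) : D != 0 ->
  is_minimum [set x : R | 0 < x /\ eigenvalue (D^T *m D) x]
    (smallest_positive_eigenvalue (D^T *m D)).
Proof.
move=> /pos_eigenvalue_gram ex; apply: xgetPex.
apply: is_minimum_finite => //; set A := D^T *m D.
apply: (@sub_finite_set _ _ (root (char_poly A))).
  by move=> x [_]; rewrite /= eigenvalue_root_char.
have p0 := monic_neq0 (char_poly_monic A).
have [s ss] : exists s : seq R, forall x, root (char_poly A) x -> x \in s.
  apply: contrapT => ns.
  suff [s] : exists s : seq R, [/\ uniq s, all (root (char_poly A)) s &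
                                   size s = size (char_poly A)].
    by case=> us rs ss; have := max_poly_roots p0 rs us; rewrite ss ltnn.
  elim: (size _) => [|k [s [us rs sk]]]; first by exists [::].
  have [x xr xs] : exists2 x, root (char_poly A) x & x \notin s.
    apply: contrapT => nx; apply: ns; exists s => x rx.
    by apply: contrapT => /negP xs; apply: nx; exists x.
  by exists (x :: s); rewrite /= xs us xr rs sk.
by apply: (@sub_finite_set _ _ [set` s]) => [x /ss|]; last exact: finite_seq.
Qed.

Lemma coboundary1_neq0 (R : realType) (d : Order.disp_t) (V : orderType d)
    (F : {fset {fset V}}) :
  triple_family F -> F != fset0 -> coboundary1 R F != 0.
Proof.
move=> tF /fset0Pn[T TF]; have T3 := tF _ TF.
have sz : size (sort <=%O T) = 3 by rewrite size_sort.
move: sz; case ET : (sort <=%O T) => [|a [|b [|c [|? ?]]]] //= _.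
have us : uniq [:: a; b; c] by rewrite -ET sort_uniq fset_uniq.
have memT x : (x \in T) = (x \in [:: a; b; c]) by rewrite -ET mem_sort.
have ab : a != b by move: us; rewrite /= inE negb_or => /andP[/andP[]].
pose e := [fset a; b].
have eT : (e `<=` T)%fset.
  by apply/fsubsetP => x; rewrite !inE memT !inE => /orP[]->; rewrite ?orbT.
have eE : e \in support_edges F.
  rewrite !inE /= fpowersetE cardfs2 ab /=; apply/andP; split; last first.
    by apply/hasP; exists T.
  apply: (fsubset_trans eT); exact: bigfcup_sup.
have iF : (index T F < #|` F|)%N by rewrite index_mem.
have jE : (index e (support_edges F) < #|` support_edges F|)%N.
  by rewrite index_mem.
apply/eqP => /matrixP /(_ (Ordinal iF) (Ordinal jE)).
rewrite !mxE /= !nth_index // /incidence ET eqxx /= => /eqP.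
by rewrite oner_eq0.
Qed.

Lemma lambdaP (R : realType) (d : Order.disp_t) (V : orderType d)
    (F : {fset {fset V}}) (D := coboundary1 R F) :
  triple_family F -> F != fset0 ->
  is_minimum [set x : R | 0 < x /\ eigenvalue (D^T *m D) x] (lambda R F).
Proof.
by move=> tF F0; apply: smallest_positive_eigenvalueP; exact: coboundary1_neq0.
Qed.

Lemma phiP (R : realType) (t : nat) :
  is_maximum (lambda_values R t) (phi R t).
Proof.
apply: xgetPex; apply: is_maximum_finite; last first.
  pose F : {fset {fset nat}} :=
    [fset [fset 0%N; 1%N; k.+2] | k in iota 0 t].
  exists (lambda R F), _, nat, F; split => //.
    move=> T /imfsetP[k _ ->].
    by rewrite fsetUC cardfsU1 cardfs2 !inE.
  rewrite card_in_imfset /=; last first.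
    move=> i j _ _ /fsetP/(_ i.+2); rewrite !inE eqxx orbT.
    by move=> /esym/eqP[].
  by rewrite undup_id ?iota_uniq ?size_iota.
pose g (k : 'I_3) : R :=
  if val k == 0%N then 0 else if val k == 1%N then 1 else -1.
pose L n (M : 'M['I_3]_(t, n)) : R :=
  smallest_positive_eigenvalue ((map_mx g M)^T *m map_mx g M).
apply: (@sub_finite_set _ _
  (\bigcup_(n in `I_(2 ^ (3 * t)).+1) range (@L n))); last first.
  apply: bigcup_finite => [|n _]; first exact: finite_II.
  apply: finite_image; exact: finite_finset.
move=> _ [d [V [F [tF Ft <-]]]]; subst t.
exists #|` support_edges F| => /=.
  rewrite ltnS; apply: (@leq_trans #|` fpowerset (support_vertices F)|).
    by apply: fsubset_leq_card; exact: fset_sub.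
  rewrite card_fpowerset leq_pexp2l //.
  apply: (leq_trans (leq_card_fcover F)).
  rewrite (eq_big_seq (fun=> 3%N)); last by move=> T /tF.
  by rewrite big_const_seq count_predT iter_addn_0.
pose h (x : R) : 'I_3 := if x == 0 then 0 else if x == 1 then 1 else 2%:R.
exists (map_mx h (coboundary1 R F)) => //; rewrite /L /lambda.
suff -> : map_mx g (map_mx h (coboundary1 R F)) = coboundary1 R F by [].
apply/matrixP => i j; rewrite !mxE /incidence.
have g0 : g (h 0) = 0 by rewrite /h eqxx.
have g1 : g (h 1) = 1 by rewrite /h oner_eq0 eqxx.
have gN1 : g (h (-1)) = -1.
  by rewrite /h oppr_eq0 oner_eq0 (lt_eqF (lt_trans (ltrN10 R) ltr01)).
by case: sort => [|a [|b [|c []]]] //; case: ifP => // _; case: ifP.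
Qed.

Lemma LambdaP (R : realType) (t : nat) : (0 < t)%N ->
  is_maximum [set phi R s | s in [set s : nat | (1 <= s <= t)%N]] (Lambda R t).
Proof.
move=> t0; apply: xgetPex; apply: is_maximum_finite; last first.
  by exists (phi R 1), 1%N.
apply: finite_image; apply: (@sub_finite_set _ _ `I_t.+1); last exact: finite_II.
by move=> s /= /andP[].
Qed.

Lemma maximum_bin3P (t : nat) (A := [set n : nat | ('C(n, 3) <= t)%N]) :
  is_maximum A (maximum 0%N A).
Proof.
apply: xgetPex; apply: is_maximum_finite; last by exists 0%N.
apply: (@sub_finite_set _ _ `I_t.+3); last exact: finite_II.
move=> n /=; rewrite !ltnS; case: n => [|[|[|n]]] // nt.
rewrite !ltnS; apply: leq_trans nt; elim: n => // n IH.
have b : (1 <= 'C(n.+3, 2))%N by rewrite bin_gt0.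
by have := leq_add IH b; rewrite addn1 binS.
Qed.

(* Main.v *)
Require Import Defs.
From mathcomp Require Import all_boot all_order all_algebra.
From mathcomp Require Import finmap.
From mathcomp Require Import all_classical all_reals all_analysis.
From mathcomp Require Import complex spectral zify ring.

Set Implicit Arguments.
Unset Strict Implicit.
Unset Printing Implicit Defensive.

Import Order.TTheory GRing.Theory Num.Theory.
Import numFieldNormedType.Exports.

Local Open Scope fset_scope.
Local Open Scope classical_set_scope.
Local Open Scope ring_scope.

(* Let A = D^T D with D the coboundary of the family F. If all positive
   eigenvalues of A are at least l, then A^2 - l A is positive semidefinite. An
   edge e lying in k triples has A_ee = k, and (A^2)_ee = k^2 + 2k since two
   distinct edges lie together in at most one triple; hence lambda F <= k + 2.
   So if lambda F > n, every edge lies in at least n - 1 triples, every vertex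
   on at least n edges, there are at least n + 1 vertices, and double counting
   gives at least 'C(n + 1, 3) triples. Conversely, for the family of all
   triples of an n-set, D A = n D, so n is the only positive eigenvalue. *)

(** * Spectral bounds on the diagonal of a Gram matrix *)

(** Diagonalize the complexification of [A] by a unitary [P] whose rows are eigenvectors; the
    eigenvalues are real because it is hermitian. The weight [p i] is the squared modulus of
    [P i j], and the same weights serve [A] and its square. *)
Lemma symmetric_spectral_diag (R : realType) (n : nat) (A : 'M[R]_n)
    (j : 'I_n) : A^T = A ->
  exists a p : 'I_n -> R,
    [/\ forall i, eigenvalue A (a i), forall i, 0 <= p i,
        A j j = \sum_i p i * a i & (A *m A) j j = \sum_i p i * a i ^+ 2].
Proof.
move=> symA; pose toC := @real_complex R.
pose AC : 'M[R[i]]_n := map_mx toC A.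
have hAC : AC \is hermsymmx.
  apply: realsym_hermsym.
    by apply/is_hermitianmxP; rewrite expr0 scale1r map_mx_id // map_trmx symA.
  by apply/mxOverP => i k; rewrite mxE complex_real.
have /orthomx_spectralP := hermitian_normalmx hAC.
have Pu := spectral_unitarymx AC; rewrite invmx_unitary //.
have spR := hermitian_spectral_diag_real hAC.
set P := spectralmx AC in Pu *; set sp := spectral_diag AC in spR * => ACE.
pose a i := complex.Re (sp 0 i).
have spE i : sp 0 i = toC (a i).
  by rewrite /toC /a RRe_real //; exact: (mxOverP spR).
have PPt : P *m (map_mx Num.conj P^T) = 1%:M by exact/unitarymxP.
pose p i := complex.Re (`|P i j| ^+ 2).
have pE i : (map_mx Num.conj P^T) j i * P i j = toC (p i).
  rewrite /toC /p RRe_real ?normCKC ?mxE //.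
  by rewrite ger0_real // -normCKC exprn_ge0.
(* Used twice: with [d] the spectrum for [A], and with its squares for [A *m A]. *)
have quad d : ((map_mx Num.conj P^T) *m diag_mx d *m P) j j
    = \sum_i toC (p i) * d 0 i.
  rewrite mxE; apply: eq_bigr => i _; rewrite mul_mx_diag mxE.
  by rewrite mulrAC pE.
exists a, p; split.
- move=> i; suff : eigenvalue AC (sp 0 i) by rewrite spE eigenvalue_map.
  apply/eigenvalueP; exists (row i P).
    rewrite ACE !mulmxA -row_mul PPt row1 -rowE.
    have -> : row i (diag_mx sp) = sp 0 i *: delta_mx 0 i.
      by apply/rowP => k; rewrite !mxE eqxx /= mulr_natr [k == i]eq_sym.
    by rewrite -scalemxAl -rowE.
  (* A zero row would make a diagonal entry of [P] times its adjoint vanish, whereas that product is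
     the identity. *)
  apply/eqP => r0; have /matrixP/(_ i i) := PPt; rewrite !mxE eqxx big1.
    by move/eqP; rewrite eq_sym oner_eq0.
  by move=> k _; have /rowP/(_ k) := r0; rewrite !mxE => ->; rewrite mul0r.
- by move=> i; rewrite -ler0c -[(p i)%:C%C]pE mxE mxE -normCKC exprn_ge0.
- apply: (fmorph_inj toC); rewrite rmorph_sum.
  transitivity (AC j j); first by rewrite mxE.
  rewrite ACE quad; apply: eq_bigr => i _; by rewrite spE -rmorphM.
- apply: (fmorph_inj toC); rewrite rmorph_sum.
  transitivity ((AC *m AC) j j); first by rewrite -map_mxM [RHS]mxE.
  have -> : AC *m AC =
      (map_mx Num.conj P^T) *m diag_mx (\row_k (sp 0 k ^+ 2)) *m P.
    rewrite ACE !mulmxA -(mulmxA _ P) PPt mulmx1.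
    rewrite -(mulmxA _ (diag_mx sp) (diag_mx sp)).
    by rewrite mulmx_diag.
  rewrite quad; apply: eq_bigr => i _.
  by rewrite mxE spE -rmorphXn -rmorphM.
Qed.

Lemma gram_eigenvalue_ge0 (R : realType) (m n : nat) (D : 'M[R]_(m, n))
    (x : R) :
  eigenvalue (D^T *m D) x -> 0 <= x.
Proof.
move=> /eigenvalueP[v vA v0].
have sqE k (w : 'rV[R]_k) : (w *m w^T) 0 0 = \sum_i w 0 i ^+ 2.
  by rewrite mxE; apply: eq_bigr => i _; rewrite mxE expr2.
have vv : 0 < (v *m v^T) 0 0.
  have [i vi] := rV0Pn _ v0.
  rewrite sqE (bigD1 i) //= ltr_pwDl //; last first.
    by apply: sumr_ge0 => k _; rewrite sqr_ge0.
  by rewrite lt_neqAle sqr_ge0 eq_sym expf_eq0 vi.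
rewrite -(pmulr_lge0 _ vv).
have -> : x * (v *m v^T) 0 0 = (v *m D^T *m (v *m D^T)^T) 0 0.
  by rewrite trmx_mul trmxK !mulmxA -(mulmxA v) vA -scalemxAl [RHS]mxE.
by rewrite sqE; apply: sumr_ge0 => k _; rewrite sqr_ge0.
Qed.

(** Each eigenvalue [a] is either 0 or at least [l], so [l * a <= a ^+ 2]; averaging with the
    nonnegative weights [p] gives the bound. *)
Lemma gram_diag_bound (R : realType) (m n : nat) (D : 'M[R]_(m, n)) (l : R)
    (A := D^T *m D) (j : 'I_n) :
  lbound [set x : R | 0 < x /\ eigenvalue A x] l ->
  l * A j j <= (A *m A) j j.
Proof.
move=> lA; have symA : A^T = A by rewrite trmx_mul trmxK.
have [a [p [eA p0 -> ->]]] := symmetric_spectral_diag j symA.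
rewrite mulr_sumr; apply: ler_sum => i _; rewrite mulrCA ler_wpM2l // expr2.
have := gram_eigenvalue_ge0 (eA i); rewrite le_eqVlt => /orP[/eqP <-|ai].
  by rewrite !mulr0.
by rewrite ler_wpM2r ?(ltW ai) //; apply: lA; split.
Qed.

(** * Triples, their pairs and incidence numbers *)

Lemma sum_nth_fset (K : choiceType) (R : nmodType) (x0 : K) (A : {fset K})
    (f : K -> R) :
  \sum_(i < #|` A|) f (nth x0 A i) = \sum_(x <- A) f x.
Proof. by rewrite (big_nth x0) big_mkord. Qed.

Lemma sort_triple (d : Order.disp_t) (V : orderType d) (T : {fset V}) :
  #|` T| = 3%N -> exists a b c,
    [/\ (a < b)%O, (b < c)%O, sort <=%O T = [:: a; b; c] & T = [fset a; b; c]].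
Proof.
move=> T3; have : size (sort <=%O T) = 3%N by rewrite size_sort.
case ET : (sort <=%O T) => [|a [|b [|c [|? ?]]]] //= _.
have us : uniq (sort <=%O T) by rewrite sort_uniq fset_uniq.
have ss : sorted <=%O (sort <=%O T) by apply: sort_sorted; exact: le_total.
have : sorted <%O (sort <=%O T) by rewrite lt_sorted_uniq_le us ss.
rewrite ET /= => /and3P[ab bc _]; exists a, b, c; split=> //.
by apply/fsetP => x; rewrite -(mem_sort <=%O) ET !inE orbA.
Qed.

(** The three pairs of a triple are distinct, so the nested tests become a signed sum of indicators,
    which distributes over sums on edges. *)
Lemma incidence_triple (R : realType) (d : Order.disp_t) (V : orderType d)
    (a b c : V) (e : {fset V}) : (a < b)%O -> (b < c)%O ->
  incidence R [fset a; b; c] e =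
    (e == [fset a; b])%:R + (e == [fset b; c])%:R - (e == [fset a; c])%:R.
Proof.
move=> ab bc; have ac := lt_trans ab bc; rewrite /incidence.
have -> : sort <=%O [fset a; b; c] = [:: a; b; c].
  apply: (@sorted_eq _ <=%O le_trans le_anti).
  - by apply: sort_sorted; exact: le_total.
  - by rewrite /= (ltW ab) (ltW bc).
  - rewrite perm_sort; apply: uniq_perm; first exact: fset_uniq.
      by rewrite /= !inE negb_or (lt_eqF ab) (lt_eqF bc) (lt_eqF ac).
    by move=> x; rewrite !inE orbA.
have n1 : ([fset a; b] == [fset b; c]) = false.
  apply/negP => /eqP/fsetP/(_ a).
  by rewrite !inE eqxx (lt_eqF ab) (lt_eqF ac).
have n2 : ([fset a; b] == [fset a; c]) = false.
  apply/negP => /eqP/fsetP/(_ b).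
  by rewrite !inE eqxx (gt_eqF ab) (lt_eqF bc).
have n3 : ([fset b; c] == [fset a; c]) = false.
  apply/negP => /eqP/fsetP/(_ b).
  by rewrite !inE eqxx (gt_eqF ab) (lt_eqF bc).
have [->|_] := eqVneq e [fset a; b]; first by rewrite n1 n2 addr0 subr0.
have [->|_] := eqVneq e [fset b; c]; first by rewrite n3 add0r subr0.
by case: eqP; rewrite /= !add0r ?oppr0.
Qed.

Lemma card_fset2P (K : choiceType) (e : {fset K}) :
  #|` e| = 2%N -> exists x y, x != y /\ e = [fset x; y].
Proof.
move=> e2; have /fset0Pn[x xe] : e != fset0 by rewrite -cardfs_gt0 e2.
have : #|` (e `\ x)%fset| == 1%N
    by have := cardfsD1 x e; rewrite xe e2 /= add1n => -[<-].
move=> /cardfs1P[y ey]; exists x, y; split; last first.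
  by rewrite -(fsetD1K xe) ey.
by have /fsetP/(_ y) := ey; rewrite !inE eqxx eq_sym => /andP[].
Qed.

Lemma pair_in_triple (K : choiceType) (a b c : K) (e : {fset K}) :
  #|` e| = 2%N -> a != b -> b != c -> a != c ->
  (e `<=` [fset a; b; c])%fset
    = (e \in [:: [fset a; b]; [fset b; c]; [fset a; c]]).
Proof.
move=> e2 ab bc ac; apply/idP/idP => [eT|].
  have [x [y [xy ee]]] := card_fset2P e2.
  have [xT yT] : x \in [fset a; b; c] /\ y \in [fset a; b; c].
    by split; apply: (fsubsetP eT); rewrite ee !inE eqxx ?orbT.
  move: xT yT; rewrite !inE ee -!orbA.
  move=> /or3P[]/eqP ? /or3P[]/eqP ?; subst x y; move: xy;
  rewrite ?eqxx // => _;
  by rewrite ?eqxx ?orbT // fsetUC eqxx ?orbT.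
rewrite !inE => /or3P[]/eqP->; apply/fsubsetP => x; rewrite !inE;
by move=> /orP[]->; rewrite ?orbT.
Qed.

Lemma incidence_sqr (R : realType) (d : Order.disp_t) (V : orderType d)
    (T e : {fset V}) : #|` T| = 3%N -> #|` e| = 2%N ->
  incidence R T e ^+ 2 = (e `<=` T)%fset%:R.
Proof.
move=> T3 e2; have [a [b [c [ab bc sT TE]]]] := sort_triple T3.
have ac := lt_trans ab bc.
rewrite {2}TE pair_in_triple ?lt_eqF // !inE orbA /incidence sT.
by case: orP => _ /=; [|case: eqP => _ /=]; rewrite ?sqrrN ?expr1n ?expr0n.
Qed.

Lemma bin3_ffact n : ('C(n, 3) * 6 = n * (n.-1 * n.-2))%N.
Proof. by rewrite -[6%N]/(3`!) bin_ffact !ffactnS ffactn0 muln1. Qed.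

(** * Edge degrees, the bound on [lambda] and double counting *)

Section UpperBound.
Context {d : Order.disp_t} {V : orderType d}.
Implicit Types (T e : {fset V}) (F : {fset {fset V}}).

Definition edge_degree F e : nat := count (fun T => (e `<=` T)%fset) F.

Lemma triple_pairs_le3 T (s : seq {fset V}) :
  #|` T| = 3%N -> uniq s -> {in s, forall e, #|` e| = 2%N} ->
  (count (fun e => (e `<=` T)%fset) s <= 3)%N.
Proof.
move=> T3 us s2; have [a [b [c [ab bc _ TE]]]] := sort_triple T3.
have ac := lt_trans ab bc; rewrite -size_filter.
apply: (@uniq_leq_size _ _ [:: [fset a; b]; [fset b; c]; [fset a; c]]).
  exact: filter_uniq.
move=> e; rewrite mem_filter => /andP[eT es]; move: eT.
by rewrite TE pair_in_triple ?lt_eqF ?s2.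
Qed.

(** The union of two distinct pairs has more than two elements, so inside a triple it is the whole
    triple. *)
Lemma triple_eq_fsetU T e e' : #|` T| = 3%N -> #|` e| = 2%N -> #|` e'| = 2%N ->
  e != e' -> (e `<=` T)%fset -> (e' `<=` T)%fset -> T = (e `|` e')%fset.
Proof.
move=> T3 e2 e2' ee' eT eT'; apply/esym/eqP.
rewrite eqEfcard fsubUset eT eT' T3 -e2 /=; apply: fproper_ltn_card.
rewrite fproperEneq fsubsetUl andbT; apply: contra_neq ee' => E.
apply/esym/eqP; rewrite eqEfcard e2 e2' leqnn andbT E; exact: fsubsetUr.
Qed.

Lemma support_edgesP {F e} :
  reflect (#|` e| = 2%N /\ exists2 T, T \in F & (e `<=` T)%fset)
          (e \in support_edges F).
Proof.
rewrite !inE /= fpowersetE; apply: (iffP and3P).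
  by move=> [_ /eqP e2 /hasP[T TF eT]]; split=> //; exists T.
move=> [e2 [T TF eT]]; split; [|by rewrite e2|by apply/hasP; exists T].
by apply: (fsubset_trans eT); exact: bigfcup_sup.
Qed.

(** Only the triple [e U e'] can contribute, so the sum has at most one nonzero term, equal to 1 or
    -1, and squaring creates no cross terms. *)
Lemma sum_incidence_sqr (R : realType) F e e' :
  triple_family F -> #|` e| = 2%N -> #|` e'| = 2%N -> e != e' ->
  (\sum_(T <- F) incidence R T e * incidence R T e') ^+ 2 =
    (\sum_(T <- F) ((e `<=` T)%fset && (e' `<=` T)%fset))%:R.
Proof.
move=> tF e2 e2' ee'; pose s T := incidence R T e * incidence R T e'.
have sE T : T \in F ->
    s T ^+ 2 = ((e `<=` T)%fset && (e' `<=` T)%fset)%:R.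
  by move=> /tF T3; rewrite exprMn !incidence_sqr // -natrM mulnb.
have s0 T : T \in F -> T != (e `|` e')%fset -> s T = 0.
  move=> TF /eqP TN; apply/eqP; rewrite -[_ == 0]sqrf_eq0 sE //.
  case: andP => // -[eT eT']; case: TN; exact: (triple_eq_fsetU (tF _ TF)).
rewrite natr_sum (eq_big_seq _ (fun T TF => esym (sE T TF))) -/s.
have [UF|UF] := boolP ((e `|` e')%fset \in F).
  rewrite !(bigD1_seq (e `|` e')%fset) ?fset_uniq //=.
  rewrite big_seq_cond big1 => [|T /andP[TF TN]]; last exact: s0.
  rewrite big_seq_cond big1 => [|T /andP[TF TN]]; last by rewrite s0 ?expr0n.
  by rewrite !addr0.
have sF T : T \in F -> s T = 0.
  by move=> TF; apply: s0 => //; apply: contraNneq UF => <-.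
rewrite -/s [in LHS]big_seq big1 // [RHS]big_seq big1 ?expr0n // => T TF.
by rewrite sF ?expr0n.
Qed.

Lemma lambda_le_edge_degree (R : realType) F e :
  triple_family F -> e \in support_edges F ->
  lambda R F <= (edge_degree F e).+2%:R.
Proof.
move=> tF eE; have [e2 [T0 T0F eT0]] := support_edgesP eE.
have F0 : F != fset0 by apply/fset0Pn; exists T0.
set dg := edge_degree F e.
have dg0 : (0 < dg)%N by rewrite -has_count; apply/hasP; exists T0.
have jE : (index e (support_edges F) < #|` support_edges F|)%N.
  by rewrite index_mem.
pose j := Ordinal jE.
have [_ lb] := lambdaP R tF F0; have := gram_diag_bound j lb.
set A := _ *m coboundary1 R F.
have AE k : A j k = \sum_(T <- F)
    incidence R T e * incidence R T (nth fset0 (support_edges F) k).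
  rewrite -(sum_nth_fset fset0) mxE; apply: eq_bigr => i _.
  by rewrite !mxE /= nth_index.
have symA k : A k j = A j k.
  by rewrite -[in LHS](_ : A^T = A) ?mxE // trmx_mul trmxK.
have Ajj : A j j = dg%:R.
  rewrite AE /= nth_index // /dg /edge_degree -sum1_count.
  rewrite natr_sum [RHS]big_mkcond /=; apply: eq_big_seq => T /tF T3.
  by rewrite -expr2 incidence_sqr //; case: (_ `<=` _)%fset.
have -> : (A *m A) j j = dg%:R ^+ 2 + \sum_(e' <- support_edges F | e' != e)
    (\sum_(T <- F) incidence R T e * incidence R T e') ^+ 2.
  rewrite mxE (bigD1 j) //= Ajj -expr2; congr (_ + _).
  rewrite [RHS]big_mkcond /= -(sum_nth_fset fset0) [LHS]big_mkcond /=.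
  apply: eq_bigr => k _; rewrite symA -expr2 AE.
  have -> // : (nth fset0 (support_edges F) k != e) = (k != j).
  by rewrite -[X in _ != X](nth_index fset0 eE) nth_uniq ?fset_uniq.
have -> : \sum_(e' <- support_edges F | e' != e)
    (\sum_(T <- F) incidence R T e * incidence R T e') ^+ 2
  = (\sum_(e' <- support_edges F | e' != e)
      \sum_(T <- F) ((e `<=` T)%fset && (e' `<=` T)%fset))%:R :> R.
  rewrite natr_sum big_seq_cond [RHS]big_seq_cond; apply: eq_bigr => e'.
  move=> /andP[/support_edgesP[e2' _] ee'].
  by rewrite sum_incidence_sqr // eq_sym.
rewrite Ajj -natrX -natrD => lA; rewrite -(ler_pM2r (_ : 0 < dg%:R)) ?ltr0n //.
apply: le_trans lA _; rewrite -natrM ler_nat -(addn2 dg) mulnDl mulnn.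
(* It remains to bound by [2 * dg] the number of pairs made of an edge [e'] other than [e] and a
   triple containing both. Summing over triples first, each of the [dg] triples through [e] has at
   most two such edges. *)
rewrite leq_add2l exchange_big /=.
rewrite /dg /edge_degree -sum1_count big_distrr /= [X in (_ <= X)%N]big_mkcond.
rewrite big_seq [X in (_ <= X)%N]big_seq; apply: leq_sum => T TF.
case: ifP => eT; last by rewrite big1.
have := @triple_pairs_le3 T (support_edges F) (tF _ TF) (fset_uniq _) _.
rewrite (eq_bigr (fun e' => nat_of_bool (e' `<=` T)%fset)) // => H.
have {}H := H (fun e' ee' => proj1 (support_edgesP ee')).
(* The bound 3 counts [e] itself, which leaves 2 for the other edges. *)
rewrite -ltnS; apply: leq_trans H.
rewrite -sum1_count [X in (_ <= X)%N]big_mkcond /=.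
rewrite [X in (_ <= X)%N](bigD1_seq e) ?fset_uniq //= eT add1n ltnS.
apply: leq_sum => e' _.
by case: (_ `<=` _)%fset.
Qed.

Lemma pair_has_vertex e v : #|` e| = 2%N -> v \in e ->
  exists2 w, w != v & e = [fset v; w].
Proof.
move=> e2 ve; have [x [y [xy eE]]] := card_fset2P e2.
move: ve; rewrite eE !inE => /orP[]/eqP ->; first by exists y; rewrite 1?eq_sym.
by exists x => //; rewrite fsetUC.
Qed.

Lemma mem_star (E : {fset {fset V}}) v e :
  (e \in [fset e' in E | v \in e']) = (e \in E) && (v \in e).
Proof. by rewrite !inE. Qed.

(** Fix an edge [{v, w}]. Each triple [U] through it yields the edge obtained from [U] by deleting
    [w]; these edges are distinct, contain [v] and avoid [w]. The edge [{v, w}] itself is one more,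
    whence the strict inequality. *)
Lemma leq_vertex_degree F v m : triple_family F -> v \in support_vertices F ->
  {in support_edges F, forall e, (m <= edge_degree F e)%N} ->
  (m < #|` [fset e in support_edges F | v \in e]|)%N.
Proof.
move=> tF vV degF; have /bigfcupP[T /andP[TF _] vT] := vV.
have [w wT wv] : exists2 w, w \in T & w != v.
  have /fset0Pn[w] : (T `\ v)%fset != fset0.
    by rewrite -cardfs_gt0; have := cardfsD1 v T; rewrite (tF _ TF) vT; lia.
  by rewrite !inE => /andP[wv wT]; exists w.
pose e0 := [fset v; w].
have e0T : (e0 `<=` T)%fset.
  by apply/fsubsetP => x; rewrite !inE => /orP[]/eqP ->.
have e0E : e0 \in support_edges F.
  apply/support_edgesP; split; last by exists T.
  by rewrite cardfs2 eq_sym wv.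
apply: leq_ltn_trans (degF _ e0E) _.
pose G := [fset U in F | (e0 `<=` U)%fset].
have memG U : (U \in G) = (U \in F) && (e0 `<=` U)%fset by rewrite !inE.
have e0U U : (e0 `<=` U)%fset -> v \in U /\ w \in U.
  by move=> /fsubsetP sU; split; apply: sU; rewrite !inE eqxx ?orbT.
have -> : edge_degree F e0 = #|` [fset (U `\ w)%fset | U in G]|.
  rewrite card_in_imfset /=.
    rewrite /edge_degree -size_filter; apply/perm_size/uniq_perm.
    - exact/filter_uniq/fset_uniq.
    - exact: fset_uniq.
    by move=> U; rewrite mem_filter memG andbC.
  move=> U U'; rewrite !memG => /andP[_ /e0U[_ wU]] /andP[_ /e0U[_ wU']] E.
  by rewrite -(fsetD1K wU) E fsetD1K.
apply: fproper_ltn_card; rewrite fproperE; apply/andP; split.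
  apply/fsubsetP => e /imfsetP[U /=]; rewrite memG => /andP[UF e0sU] ->.
  have [vU wU] := e0U _ e0sU.
  rewrite mem_star in_fsetD1 vU [v == w]eq_sym wv !andbT.
  apply/support_edgesP; split; last by exists U => //; exact: fsubD1set.
  by have := cardfsD1 w U; rewrite wU (tF _ UF); lia.
apply/fsubsetPn; exists e0; first by rewrite mem_star e0E !inE eqxx.
apply/imfsetP => -[U /= _ /fsetP/(_ w)]; by rewrite !inE eqxx orbT.
Qed.

Lemma bin3_le_card_triples F m : triple_family F -> F != fset0 ->
  {in support_edges F, forall e, (m <= edge_degree F e)%N} ->
  ('C(m.+2, 3) <= #|` F|)%N.
Proof.
move=> tF F0 degF; set E := support_edges F; set X := support_vertices F.
have E2 e : e \in E -> #|` e| = 2%N by move=> /support_edgesP[].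
(* Count incident pairs of an edge and a triple. *)
have FE : (#|` E| * m <= 3 * #|` F|)%N.
  have -> : (#|` E| * m = \sum_(e <- E) m)%N.
    by rewrite big_const_seq count_predT iter_addn_0 mulnC.
  apply: (@leq_trans (\sum_(e <- E) edge_degree F e)).
    by rewrite big_seq [X in (_ <= X)%N]big_seq; apply: leq_sum.
  under eq_bigr do rewrite /edge_degree -sum1_count big_mkcond /=.
  rewrite exchange_big /=.
  have -> : (3 * #|` F| = \sum_(T <- F) 3)%N.
    by rewrite big_const_seq count_predT iter_addn_0.
  rewrite big_seq [X in (_ <= X)%N]big_seq; apply: leq_sum => T TF.
  rewrite -big_mkcond sum1_count; apply: triple_pairs_le3 => //.
    exact: tF.
  exact: fset_uniq.
(* Count incident pairs of a vertex and an edge. *)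
have EX : (#|` X| * m.+1 <= 2 * #|` E|)%N.
  have -> : (#|` X| * m.+1 = \sum_(v <- X) m.+1)%N.
    by rewrite big_const_seq count_predT iter_addn_0 mulnC.
  apply: (@leq_trans (\sum_(v <- X) \sum_(e <- E) (v \in e))).
    rewrite big_seq [X in (_ <= X)%N]big_seq; apply: leq_sum => v vX.
    apply: leq_trans (leq_vertex_degree tF vX degF) _.
    by rewrite card_fset_sum1 big_fset /= big_mkcond.
  rewrite exchange_big /=.
  have -> : (2 * #|` E| = \sum_(e <- E) 2)%N.
    by rewrite big_const_seq count_predT iter_addn_0.
  rewrite big_seq [X in (_ <= X)%N]big_seq; apply: leq_sum => e eE.
  rewrite -(E2 _ eE).
  have -> : (\sum_(v <- X) (v \in e) = \sum_(v <- X | v \in e) 1)%N.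
    by rewrite [RHS]big_mkcond.
  rewrite sum1_count -size_filter; apply: uniq_leq_size.
    exact/filter_uniq/fset_uniq.
  by move=> v; rewrite mem_filter => /andP[].
(* The more than [m] edges at a vertex [v] all have the form [{v, w}] with [w] among the other
   vertices. *)
have Xm : (m.+2 <= #|` X|)%N.
  have /fset0Pn[T TF] := F0.
  have /fset0Pn[v vT] : T != fset0 by rewrite -cardfs_gt0 (tF _ TF).
  have vX : v \in X by apply/bigfcupP; exists T => //; rewrite TF.
  rewrite (cardfsD1 v) vX add1n ltnS.
  apply: leq_trans (leq_vertex_degree tF vX degF) _.
  apply: (@leq_trans #|` [fset [fset v; w] | w in (X `\ v)%fset]|); last first.
    by rewrite leq_imfset_card.
  apply: fsubset_leq_card; apply/fsubsetP => e.
  rewrite mem_star => /andP[eE ve].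
  have [w wv ee] := pair_has_vertex (E2 _ eE) ve.
  apply/imfsetP; exists w => //=; rewrite !inE wv /=.
  have /support_edgesP[_ [U UF /fsubsetP eU]] := eE.
  apply/bigfcupP; exists U; first by rewrite UF.
  by apply: eU; rewrite ee !inE eqxx orbT.
(* With [f], [e], [x] the numbers of triples, edges and vertices, [6 f >= 2 e m >= x (m + 1) m >= (m
   + 2) (m + 1) m]. *)
have B : ('C(m.+2, 3) * 6 = m.+2 * (m.+1 * m))%N := bin3_ffact m.+2.
nia.
Qed.

End UpperBound.

(** * The spectrum of the family of all triples of an [n]-set *)

Definition complete_triples (n : nat) : {fset {fset 'I_n}} :=
  [fset T in {: {fset 'I_n}} | #|` T| == 3%N].

Lemma mem_complete_triples n (T : {fset 'I_n}) :
  (T \in complete_triples n) = (#|` T| == 3%N).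
Proof. by rewrite !inE. Qed.

Lemma triple_family_complete n : triple_family (complete_triples n).
Proof. by move=> T; rewrite mem_complete_triples => /eqP. Qed.

Lemma card_complete_triples n : #|` complete_triples n| = 'C(n, 3).
Proof.
pose h (A : {set 'I_n}) : {fset 'I_n} := [fset x in A].
have hK A x : (x \in h A) = (x \in A) by rewrite !inE.
have -> : complete_triples n =
    [fset h A | A in finset (fun A : {set 'I_n} => #|A| == 3%N)].
  apply/fsetP => T; rewrite mem_complete_triples.
  apply/idP/imfsetP => [T3|[A /=]].
    have TE : T = h (finset (fun x => x \in T)).
      by apply/fsetP => x; rewrite hK inE.
    exists (finset (fun x => x \in T)) => //=.
    by rewrite inE -(eqP T3) {2}TE card_finset.
  by rewrite inE => A3 ->; rewrite card_finset.
rewrite card_imfset /=; last first.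
  by move=> A B /fsetP AB; apply/setP => x; rewrite -!hK.
by rewrite -cardE card_draws card_ord.
Qed.

(** The third vertex parametrizes the triples through a fixed pair bijectively. *)
Lemma sum_complete_triples (R : nmodType) n (a b : 'I_n)
    (f : {fset 'I_n} -> R) : a != b ->
  \sum_(T <- complete_triples n | ([fset a; b] `<=` T)%fset) f T =
    \sum_(c | (c != a) && (c != b)) f [fset a; b; c].
Proof.
move=> ab; rewrite -big_filter.
rewrite (perm_big [seq [fset a; b; c] |
    c <- enum 'I_n & (c != a) && (c != b)]); last first.
  apply: uniq_perm.
  - exact/filter_uniq/fset_uniq.
  - rewrite map_inj_in_uniq; first exact/filter_uniq/enum_uniq.
    move=> c c'.
    rewrite !mem_filter => /andP[/andP[ca cb] _] _ /fsetP/(_ c).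
    by rewrite !inE eqxx orbT (negPf ca) (negPf cb) => /esym/eqP.
  - move=> T; rewrite mem_filter mem_complete_triples.
    apply/andP/mapP => [[abT T3]|[c]].
      have : #|` (T `\` [fset a; b])%fset| == 1%N.
        by rewrite cardfsDS // (eqP T3) cardfs2 ab.
      move=> /cardfs1P[c cE]; exists c.
        rewrite mem_filter mem_enum andbT.
        by have /fsetP/(_ c) := cE; rewrite !inE eqxx negb_or => /andP[].
      by rewrite -cE fsetUDl (fsetUidPr _ _ abT) fsetDv fsetD0.
    rewrite mem_filter => /andP[/andP[ca cb] _] ->; split.
      exact: fsubsetUl.
    by rewrite fsetUC cardfsU1 cardfs2 ab !inE negb_or ca cb.
by rewrite big_map big_filter big_enum_cond.
Qed.

Lemma pair_in_complete n (a b : 'I_n) : (2 < n)%N -> a != b ->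
  [fset a; b] \in support_edges (complete_triples n).
Proof.
move=> n2 ab; apply/support_edgesP.
rewrite cardfs2 ab; split=> //.
have : [exists c, (c != a) && (c != b)].
  apply: contraLR n2; rewrite negb_exists => /forallP nc; rewrite -leqNgt.
  (* If no third vertex existed, all of ['I_n] would lie in [{a, b}]. The number 2 is recast as
     [(a != b).+1], the shape [cards2] expects. *)
  rewrite -[n]card_ord -cardsT -[2%N]/(true.+1) -ab -cards2.
  apply: subset_leq_card; apply/fintype.subsetP => c _; rewrite !inE.
  by have := nc c; rewrite negb_and !negbK.
move=> /existsP[c /andP[ca cb]]; exists [fset a; b; c]; last exact: fsubsetUl.
by rewrite mem_complete_triples fsetUC cardfsU1 cardfs2 ab !inE negb_or ca cb.
Qed.

(** Read an eigenvector as an alternating function [g] with coboundary [Y]. The eigenvalue equation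
    says that [x * g a b] is the sum of [Y] over all third vertices. Applying the coboundary to it
    gives [x * Y = n * Y], and [Y] is nonzero somewhere. *)
Lemma eigenvalue_complete (R : realType) n (x : R)
    (D := coboundary1 R (complete_triples n)) : (2 < n)%N ->
  x != 0 -> eigenvalue (D^T *m D) x -> x = n%:R.
Proof.
move=> n2 x0 /eigenvalueP[v vA v0].
pose F := complete_triples n; pose E := support_edges F.
have tF : triple_family F := @triple_family_complete n.
(* The coordinates of [v] indexed by sets instead of positions, with value 0 off the support
   edges. *)
pose w (e : {fset 'I_n}) : R :=
  \sum_(j < #|` E|) v 0 j * (nth fset0 E j == e)%:R.
have wE (j : 'I_#|` E|) : w (nth fset0 E j) = v 0 j.
  rewrite /w (bigD1 j) //= eqxx mulr1 big1 ?addr0 // => k kj.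
  by rewrite nth_uniq ?fset_uniq // (negPf kj : (k == j :> nat) = false) mulr0.
(* Extending v alternatingly to ordered pairs makes the degenerate terms of the
   sums over a third vertex vanish, so these can range over all of 'I_n. *)
pose g (a b : 'I_n) : R := if (a < b)%O then w [fset a; b]
  else if (b < a)%O then - w [fset a; b] else 0.
have gN a b : g a b = - g b a.
  by rewrite /g fsetUC; case: ltgtP => // _; rewrite ?opprK ?oppr0.
have glt (a b : 'I_n) : (a < b)%O -> g a b = w [fset a; b] by rewrite /g => ->.
pose Y (T : {fset 'I_n}) : R :=
  \sum_(j < #|` E|) v 0 j * incidence R T (nth fset0 E j).
have YE (a b c : 'I_n) : (a < b)%O -> (b < c)%O ->
    Y [fset a; b; c] = g a b + g b c + g c a.
  move=> ab bc; have ac := lt_trans ab bc.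
  rewrite (gN c a) !glt // /Y /w -big_split -sumrB /=; apply: eq_bigr => j _.
  by rewrite incidence_triple // mulrBr mulrDr.
have yE (i : 'I_#|` F|) : (v *m D^T) 0 i = Y (nth fset0 F i).
  by rewrite mxE; apply: eq_bigr => j _; rewrite !mxE.
have xw (a b : 'I_n) : (a < b)%O ->
    x * g a b = \sum_(T <- F) Y T * incidence R T [fset a; b].
  move=> ab; have eE : [fset a; b] \in E.
    by apply: pair_in_complete => //; rewrite lt_eqF.
  have jE : (index [fset a; b] E < #|` E|)%N by rewrite index_mem.
  have /rowP/(_ (Ordinal jE)) := vA.
  rewrite mulmxA [RHS]mxE -wE /= nth_index // glt // => <-.
  rewrite mxE -(sum_nth_fset fset0); apply: eq_bigr => i _.
  by rewrite yE !mxE /= nth_index.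
(* The incidence number is -1 exactly when [c] lies between [a] and [b]; then sorting the triple
   also reverses its orientation, and the two signs cancel. *)
have YI (a b c : 'I_n) : (a < b)%O -> c != a -> c != b ->
    Y [fset a; b; c] * incidence R [fset a; b; c] [fset a; b]
    = g a b + g b c + g c a.
  move=> ab ca cb; have ba : b != a by rewrite gt_eqF.
  have nab (e : {fset 'I_n}) : c \in e -> ([fset a; b] == e) = false.
    move=> ce; apply/negP => /eqP abe.
    by rewrite -abe !inE (negPf ca) (negPf cb) in ce.
  have cin u : (c \in [fset c; u]) * (c \in [fset u; c]).
    by rewrite !inE eqxx orbT.
  have [ac|ca'|/eqP] := ltgtP a c; last by rewrite eq_sym (negPf ca).
    have [bc|cb'|/eqP] := ltgtP b c; last by rewrite eq_sym (negPf cb).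
      by rewrite incidence_triple // YE // eqxx !nab ?cin //=; ring.
    have -> : [fset a; b; c] = [fset a; c; b] by rewrite fsetUAC.
    rewrite incidence_triple // YE // eqxx !nab ?cin //=.
    by rewrite (gN b a) (gN a c) (gN c b); ring.
  have -> : [fset a; b; c] = [fset c; a; b] by rewrite fsetUC fsetUA.
  by rewrite incidence_triple // YE // eqxx !nab ?cin //=; ring.
have xg (a b : 'I_n) : x * g a b = \sum_c (g a b + g b c + g c a).
  wlog ab : a b / (a < b)%O.
    move=> H; have [ab|ba|->] := ltgtP a b; first exact: H.
      rewrite gN mulrN H // -sumrN; apply: eq_bigr => c _.
      by rewrite (gN b a) (gN a c) (gN c b); ring.
    have gbb : g b b = 0 by rewrite /g ltxx.
    by rewrite gbb mulr0 big1 // => c _; rewrite (gN c b); ring.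
  have gaa z : g z z = 0 by rewrite /g ltxx.
  rewrite xw // (bigID (fun T => ([fset a; b] `<=` T)%fset)) /=.
  rewrite [X in _ + X]big_seq_cond [X in _ + X]big1 ?addr0; last first.
    move=> T /andP[TF /negPf eT].
    have : incidence R T [fset a; b] ^+ 2 == 0.
      rewrite incidence_sqr; [by rewrite eT|exact: tF|].
      by rewrite cardfs2 lt_eqF.
    by rewrite sqrf_eq0 => /eqP ->; rewrite mulr0.
  rewrite /F sum_complete_triples ?lt_eqF //.
  rewrite [RHS](bigID (fun c => (c != a) && (c != b))) /=.
  rewrite [X in _ = _ + X]big1 ?addr0; last first.
    move=> c; rewrite negb_and !negbK => /orP[]/eqP->.
      by rewrite gaa (gN b a); ring.
    by rewrite gaa (gN b a); ring.
  by apply: eq_bigr => c /andP[ca cb]; exact: YI.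
(* Expand by [xg]. For each [z], the coboundaries of the three triples formed by [z] and a side of
   [a b c] add up to that of [a b c], since the terms containing [z] cancel in pairs. *)
have xY (a b c : 'I_n) :
    x * (g a b + g b c + g c a) = n%:R * (g a b + g b c + g c a).
  rewrite !mulrDr !xg -!big_split /= -!mulrDr.
  rewrite (eq_bigr (fun=> g a b + g b c + g c a)) => [|z _].
    by rewrite sumr_const card_ord mulr_natl.
  by rewrite (gN z a) (gN z b) (gN z c); ring.
(* A vanishing coboundary would give [x *: v = 0], contrary to [x] and [v] being nonzero. *)
have [y0|/rV0Pn[i yi]] := eqVneq (v *m D^T) 0.
  move: vA; rewrite mulmxA y0 mul0mx => /esym/eqP.
  by rewrite scaler_eq0 (negPf x0) (negPf v0).
have := tF _ (mem_nth fset0 (ltn_ord i : (i < size F)%N)) => T3.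
have [a [b [c [ab bc _ TE]]]] := sort_triple T3.
move: yi; rewrite yE TE YE // => nz.
by apply: (mulIf nz); rewrite xY.
Qed.

Lemma lambda_complete (R : realType) n : (2 < n)%N ->
  lambda R (complete_triples n) = n%:R.
Proof.
move=> n2; have F0 : complete_triples n != fset0.
  by rewrite -cardfs_gt0 card_complete_triples bin_gt0.
have [[l0 lE] _] := lambdaP R (@triple_family_complete n) F0.
by apply: eigenvalue_complete lE; rewrite ?gt_eqF.
Qed.

(** * The value of [Lambda] and its growth *)

Lemma lambda_le_nat (R : realType) (d : Order.disp_t) (V : orderType d)
    (F : {fset {fset V}}) (n : nat) :
  triple_family F -> F != fset0 -> (#|` F| < 'C(n.+1, 3))%N ->
  lambda R F <= n%:R.
Proof.
move=> tF F0 Fn; rewrite leNgt; apply/negP => nl.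
(* For [n <= 1] the binomial in [Fn] is 0. Hence [n.-1] is a true predecessor, and [m = n.-1] fits
   the counting lemma. *)
have n2 : (1 < n)%N by case: n Fn {nl} => [|[|n]].
have := Fn; rewrite ltnNge => /negP; apply.
have -> : n.+1 = n.-1.+2 by lia.
apply: bin3_le_card_triples => // e eE.
have := lt_le_trans nl (lambda_le_edge_degree R tF eE).
by rewrite ltr_nat; lia.
Qed.

Lemma bin3_gt1 n : (1 < 'C(n.+1, 3))%N -> (2 < n)%N.
Proof.
by apply: contraLR; rewrite -!leqNgt => n2; rewrite -(binn 3) leq_bin2l.
Qed.

(** Any family of size [s <= t] has fewer than ['C(n.+1, 3)] members, which bounds its [lambda] by
    [n]. The size ['C(n, 3)] is itself admissible, and there the family of all triples reaches
    [n]. *)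
Lemma Lambda_bin3 (R : realType) (t n : nat) : (0 < t)%N ->
  ('C(n, 3) <= t < 'C(n.+1, 3))%N -> Lambda R t = n%:R.
Proof.
move=> t0 /andP[nt tn]; have n2 := bin3_gt1 (leq_ltn_trans t0 tn).
have [[s /= /andP[s1 st] sE] ub] := LambdaP R t0.
apply/eqP; rewrite eq_le; apply/andP; split.
  rewrite -sE; have [[d [V [F [tF Fs <-]]]] _] := phiP R s.
  apply: lambda_le_nat => //; last by rewrite Fs (leq_ltn_trans st).
  by rewrite -cardfs_gt0 Fs.
apply: le_trans (ub (phi R 'C(n, 3)) _); last first.
  by exists 'C(n, 3) => //=; rewrite bin_gt0 n2.
have [_] := phiP R 'C(n, 3); apply.
exists _, _, (complete_triples n); split.
- exact: triple_family_complete.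
- exact: card_complete_triples.
- exact: lambda_complete.
Qed.

Lemma maximum_bin3_bounds (t : nat)
    (n := maximum 0%N [set n : nat | ('C(n, 3) <= t)%N]) :
  ('C(n, 3) <= t < 'C(n.+1, 3))%N.
Proof.
have [nt ub] := maximum_bin3P t; rewrite -/n in nt ub *.
apply/andP; split=> //; rewrite ltnNge; apply/negP => tn.
by have := ub _ tn; rewrite leEnat ltnn.
Qed.

(** Here [n >= 3], so [n - 2 >= n / 3] and [n - 1 >= 2 n / 3], which gives ['C(n, 3) >= n ^ 3 / 27],
    with equality at [n = 3]. The other side is crude: [6 t < (n + 1) n (n - 1) <= n ^ 3]. *)
Lemma bin3_cube_bounds (t n : nat) : (0 < t)%N ->
  ('C(n, 3) <= t < 'C(n.+1, 3))%N ->
  (n ^ 3 <= 27 * t)%N /\ (t <= (2 * n) ^ 3)%N.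
Proof.
move=> t0 /andP[nt tn]; have := bin3_ffact n; have := bin3_ffact n.+1.
have := bin3_gt1 (leq_ltn_trans t0 tn).
case: n nt tn => [|[|[|n]]] //= nt tn _ E1 E2.
have c3 k : (k ^ 3 = k * (k * k))%N by rewrite !expnS expn0 muln1.
rewrite !c3; split; nia.
Qed.

Theorem theorem3p9 (R : realType) :
  [/\ forall t : nat, (3 <= t)%N ->
        Lambda R t = (maximum 0%N [set n : nat | ('C(n, 3) <= t)%N])%:R,
      forall t : nat, (3 <= t)%N ->
        forall n : nat, ('C(n, 3) <= t < 'C(n.+1, 3))%N -> Lambda R t = n%:R
    & (Lambda R : nat -> R^o) =Theta_\oo
        ((fun t : nat => t%:R `^ 3^-1) : nat -> R^o)].
Proof.
split.
- move=> t t3; apply: Lambda_bin3 (maximum_bin3_bounds t).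
  exact: leq_trans t3.
- by move=> t t3 n; apply: Lambda_bin3; apply: leq_trans t3.
(* The constants are cube roots of those in [bin3_cube_bounds]: [t <= (2 * n) ^ 3] gives the factor
   1/2 and [n ^ 3 <= 27 * t] the factor 3. Both comparisons are made between cubes. *)
rewrite eqThetaE qualifE; apply/asboolP; exists (2^-1, 3).
  by rewrite /= invr_gt0 !ltr0n.
exists 1%N => // t /= t0.
have bt := maximum_bin3_bounds t; rewrite (Lambda_bin3 R t0 bt).
have [] := bin3_cube_bounds t0 bt; move: (maximum _ _) => n {bt} nt tn.
set r : R := t%:R `^ 3^-1.
have r0 : 0 <= r by exact: powR_ge0.
have r3 : r ^+ 3 = t%:R.
  by rewrite -powR_mulrn // -powRrM mulVf ?powRr1 ?ler0n // pnatr_eq0.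
rewrite !ger0_norm ?ler0n //; split.
  rewrite ler_pdivrMl // -(@ler_pXn2r _ 3) ?nnegrE ?mulr_ge0 ?ler0n //.
  by rewrite r3 -natrM -natrX ler_nat.
rewrite -(@ler_pXn2r _ 3) ?nnegrE ?mulr_ge0 ?ler0n //.
by rewrite exprMn r3 -!natrX -natrM ler_nat.
Qed.
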